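(* Let $A$ be a (not necessarily commutative) domain, $S=A[\underline{t};\sigma,\underline{\delta}]$ a multivariate Ore extension in $n$ variables, $\underline{a}=(a_1,\dots,a_n)^t\in A^n$, and $C^{(\sigma,\underline{\delta})}(\underline{a})$ the $(\sigma,\underline{\delta})$-centralizer of $\underline{a}$. (1) $b\in C^{(\sigma,\underline{\delta})}(\underline{a})$ if and only if for any $1\le i\le n$ we have $\sum_{j=1}^n\sigma_{ij}(b)a_j+\delta_i(b)-a_ib=0$. (2) If $I=\sum_{i=1}^n S(t_i-a_i)$, then $S/I$ is a left $S$-module and a right $C^{(\sigma,\underline{\delta})}(\underline{a})$-module. (3) There is a ring isomorphism between $C^{(\sigma,\underline{\delta})}(\underline{a})$ and $\mathrm{End}_S(S/I)$, where $I=\sum_{i=1}^nS(t_i-a_i)$. If the base ring $A$ is a division ring, these rings are in fact division rings. (4) With the same $I$, we have isomorphisms of rings $$C^{(\sigma,\underline{\delta})}(\underline{a})\cong \mathrm{End}_S(S/I)\cong \mathrm{idl}(I)/I.$$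
   Context: All rings are associative with identity. Let $n\ge 1$, $\sigma:A\to M_n(A)$ a ring homomorphism, and write $\sigma_{ij}(a)$ for the $(i,j)$ entry of $\sigma(a)$. Let $\underline{\delta}=(\delta_1,\dots,\delta_n)^t$ be a column of additive maps $A\to A$ forming a $\sigma$-derivation: $\delta_i(ab)=\sum_{j=1}^n\sigma_{ij}(a)\delta_j(b)+\delta_i(a)b$ for all $a,b\in A$, $1\le i\le n$. The multivariate Ore extension $S=A[\underline{t};\sigma,\underline{\delta}]$ is the ring of (finite) sums $\sum_{m\in M}\alpha_m m$, $\alpha_m\in A$, where $M$ is the free monoid on the variables $t_1,\dots,t_n$, with multiplication determined by concatenation in $M$ and the rules $t_ia=\sum_{j=1}^n\sigma_{ij}(a)t_j+\delta_i(a)$ for $a\in A$, $1\le i\le n$. The $(\sigma,\underline{\delta})$-centralizer of $\underline{a}\in A^n$ is $C^{(\sigma,\underline{\delta})}(\underline{a})=\{x\in A\mid \sigma(x)\underline{a}+\underline{\delta}(x)=\underline{a}x\}$, a subring of $A$ (here $\underline{\delta}(x)=(\delta_1(x),\dots,\delta_n(x))^t$ and $\underline{a}x$ has entries $a_ix$). The idealizer of a left ideal $I$ of $S$ is $\mathrm{idl}(I)=\{p\in S\mid Ip\subset I\}$, a subring of $S$ containing $I$. $\mathrm{End}_S(S/I)$ denotes the ring of endomorphisms of the left $S$-module $S/I$. *)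

(* Defs.v *)
From HB Require Import structures.
From mathcomp Require Import all_boot all_algebra.
From mathcomp Require Import finmap boolp.
From mathcomp Require Import monalg.

Set Implicit Arguments.
Unset Strict Implicit.
Unset Printing Implicit Defensive.

Import GRing.Theory.
Import Quotient.

Local Open Scope ring_scope.
Local Open Scope quotient_scope.

(* MathComp's [idomainType] is commutative, hence this predicate. *)
Definition is_domain (R : nzRingType) : Prop :=
  forall x y : R, x * y = 0 -> x = 0 \/ y = 0.

Definition is_division_ring (R : pzRingType) : Prop :=
  1 != 0 :> R /\
  forall x : R, x != 0 -> exists y : R, x * y = 1 /\ y * x = 1.

Definition ring_iso (R1 R2 : pzRingType) : Prop :=
  exists f : {rmorphism R1 -> R2}, bijective f.

Definition left_module_action (R : pzRingType) (M : zmodType)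
    (act : R -> M -> M) : Prop :=
  [/\ forall x, act 1 x = x,
      forall r s x, act (r * s) x = act r (act s x),
      forall r x y, act r (x + y) = act r x + act r y &
      forall r s x, act (r + s) x = act r x + act s x].

Definition right_module_action (R : pzRingType) (M : zmodType)
    (act : M -> R -> M) : Prop :=
  [/\ forall x, act x 1 = x,
      forall x r s, act x (r * s) = act (act x r) s,
      forall x y r, act (x + y) r = act x r + act y r &
      forall x r s, act x (r + s) = act x r + act x s].

(* A left ideal of a ring [S] is a [submodClosed S^o]. *)
Section QuotientModule.
Variables (R : pzRingType) (V : lmodType R) (I : submodClosed V).

(* [submodClosed], being about semimodules, does not provide the closure under
   opposite that [{quot _}] requires. *)
Definition submod_pred : {pred V} := [pred x : V | x \in I].

Fact submod_zmod : zmod_closed submod_pred.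
Proof.
split=> [|x y xI yI]; first exact: (@rpred0 V I).
by rewrite inE -scaleN1r rpredD // rpredZ.
Qed.

HB.instance Definition _ :=
  GRing.isZmodClosed.Build V submod_pred submod_zmod.

Definition mod_quot : Type := {quot submod_pred}.
HB.instance Definition _ := GRing.Zmodule.on mod_quot.

Definition mod_pi (x : V) : mod_quot := \pi_{quot submod_pred} x.
Definition mod_repr (x : mod_quot) : V := repr (x : {quot submod_pred}).
Definition mod_quot_scale (r : R) (x : mod_quot) : mod_quot :=
  mod_pi (r *: mod_repr x).

Lemma mod_piP (x : mod_quot) : mod_pi (mod_repr x) = x.
Proof. exact: reprK. Qed.

Lemma mod_pi_eq (x y : V) : (mod_pi x = mod_pi y) <-> (x - y \in I).
Proof.
rewrite -[x - y \in I]/(x - y \in submod_pred) idealrBE.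
by split=> [/= e|/eqP //]; apply/eqP.
Qed.

Fact mod_pi_zmod : zmod_morphism mod_pi.
Proof. exact: (raddfB \pi_{quot submod_pred}). Qed.
HB.instance Definition _ :=
  GRing.isZmodMorphism.Build V mod_quot mod_pi mod_pi_zmod.

Lemma mod_quot_scaleE (r : R) (x : V) :
  mod_quot_scale r (mod_pi x) = mod_pi (r *: x).
Proof.
by apply/mod_pi_eq; rewrite -scalerBr rpredZ //; apply/mod_pi_eq/mod_piP.
Qed.

Fact mod_quot_scaleA r s x :
  mod_quot_scale r (mod_quot_scale s x) = mod_quot_scale (r * s) x.
Proof. by rewrite -[x]mod_piP !mod_quot_scaleE scalerA. Qed.
Fact mod_quot_scale1 : left_id 1 mod_quot_scale.
Proof. by move=> x; rewrite -[x]mod_piP mod_quot_scaleE scale1r. Qed.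
Fact mod_quot_scaleDr : right_distributive mod_quot_scale +%R.
Proof.
move=> r x y; rewrite -[x]mod_piP -[y]mod_piP -raddfD !mod_quot_scaleE.
by rewrite -raddfD scalerDr.
Qed.
Fact mod_quot_scaleDl x : {morph mod_quot_scale^~ x : r s / r + s}.
Proof.
by move=> r s; rewrite -[x]mod_piP !mod_quot_scaleE -raddfD scalerDl.
Qed.

HB.instance Definition _ := GRing.Zmodule_isLmodule.Build R mod_quot
  mod_quot_scaleA mod_quot_scale1 mod_quot_scaleDr mod_quot_scaleDl.

Fact mod_pi_scalable : scalable mod_pi.
Proof. by move=> r x; apply/esym/mod_quot_scaleE. Qed.
HB.instance Definition _ :=
  GRing.isScalable.Build R V mod_quot *:%R mod_pi mod_pi_scalable.

End QuotientModule.

(* Endomorphisms of a left module are written on the right of their argument,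
   so that the product of [f] and [g] is [x |-> g (f x)].  With this
   convention the endomorphism ring of the left module [R] is [R] itself. *)
Definition lend (R : pzRingType) (M : lmodType R) : Type := {linear M -> M}.

Section EndomorphismRing.
Variables (R : pzRingType) (M : lmodType R).

HB.instance Definition _ := gen_eqMixin (lend M).
HB.instance Definition _ := gen_choiceMixin (lend M).

Definition lend_fun (f : lend M) : {linear M -> M} := f.

Lemma lendP (f g : lend M) : lend_fun f =1 lend_fun g -> f = g.
Proof.
case: f g => [f cf] [g cg] /= /funext eqfg.
rewrite -eqfg in cg *; congr GRing.Linear.Pack.
case: cf cg => [[h1] [h2]] [[k1] [k2]]; congr GRing.Linear.Class.
  by congr GRing.isNmodMorphism.Axioms_; apply: Prop_irrelevance.
by congr GRing.isScalable.Axioms_; apply: Prop_irrelevance.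
Qed.

Definition lend_zero : lend M := (\0 : M -> M).
Definition lend_opp (f : lend M) : lend M := \- (lend_fun f).
Definition lend_add (f g : lend M) : lend M := lend_fun f \+ lend_fun g.
Definition lend_one : lend M := @idfun M.
Definition lend_mul (f g : lend M) : lend M := lend_fun g \o lend_fun f.

Fact lend_addA : associative lend_add.
Proof. by move=> f g h; apply: lendP => x /=; rewrite addrA. Qed.
Fact lend_addC : commutative lend_add.
Proof. by move=> f g; apply: lendP => x /=; rewrite addrC. Qed.
Fact lend_add0 : left_id lend_zero lend_add.
Proof. by move=> f; apply: lendP => x /=; rewrite add0r. Qed.
Fact lend_addN : left_inverse lend_zero lend_opp lend_add.
Proof. by move=> f; apply: lendP => x /=; rewrite addNr. Qed.

HB.instance Definition _ :=
  GRing.isZmodule.Build (lend M) lend_addA lend_addC lend_add0 lend_addN.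

Fact lend_mulA : associative lend_mul.
Proof. by move=> f g h; apply: lendP. Qed.
Fact lend_mul1l : left_id lend_one lend_mul.
Proof. by move=> f; apply: lendP. Qed.
Fact lend_mul1r : right_id lend_one lend_mul.
Proof. by move=> f; apply: lendP. Qed.
Fact lend_mulDl : left_distributive lend_mul +%R.
Proof. by move=> f g h; apply: lendP => x /=; rewrite raddfD. Qed.
Fact lend_mulDr : right_distributive lend_mul +%R.
Proof. by move=> f g h; apply: lendP. Qed.

HB.instance Definition _ := GRing.Zmodule_isPzRing.Build (lend M)
  lend_mulA lend_mul1l lend_mul1r lend_mulDl lend_mulDr.

End EndomorphismRing.

(* Quotients of noncommutative rings, which MathComp does not provide. *)
Record two_sided_ideal (R : pzRingType) := TwoSidedIdeal {
  tsi_val :> zmodClosed R;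
  tsi_mull : forall r x : R, x \in tsi_val -> r * x \in tsi_val;
  tsi_mulr : forall x r : R, x \in tsi_val -> x * r \in tsi_val
}.

Definition ring_quot (R : pzRingType) (J : two_sided_ideal R) : Type :=
  {quot J}.

Section QuotientRing.
Variables (R : pzRingType) (J : two_sided_ideal R).

HB.instance Definition _ := GRing.Zmodule.on (ring_quot J).

Definition ring_pi (x : R) : ring_quot J := \pi_{quot J} x.
Definition ring_repr (x : ring_quot J) : R := repr (x : {quot J}).
Definition ring_quot_mul (x y : ring_quot J) : ring_quot J :=
  ring_pi (ring_repr x * ring_repr y).

Lemma ring_piP (x : ring_quot J) : ring_pi (ring_repr x) = x.
Proof. exact: reprK. Qed.

Lemma ring_pi_eq (x y : R) : (ring_pi x = ring_pi y) <-> (x - y \in J).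
Proof. by rewrite idealrBE; split=> [/= e|/eqP //]; apply/eqP. Qed.

Lemma ring_piD : {morph ring_pi : x y / x + y}.
Proof. by move=> x y; apply: (raddfD \pi_{quot J}). Qed.

Lemma ring_piM (x y : R) :
  ring_quot_mul (ring_pi x) (ring_pi y) = ring_pi (x * y).
Proof.
apply/ring_pi_eq; set x' := ring_repr _; set y' := ring_repr _.
have -> : x' * y' - x * y = (x' - x) * y' + x * (y' - y).
  by rewrite mulrBl mulrBr addrA subrK.
have xJ : x' - x \in J by apply/ring_pi_eq; rewrite ring_piP.
have yJ : y' - y \in J by apply/ring_pi_eq; rewrite ring_piP.
exact: (rpredD (tsi_mulr _ xJ) (tsi_mull _ yJ)).
Qed.

Fact ring_quot_mulA : associative ring_quot_mul.
Proof.
move=> x y z; rewrite -[x]ring_piP -[y]ring_piP -[z]ring_piP.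
by rewrite !ring_piM mulrA.
Qed.
Fact ring_quot_mul1l : left_id (ring_pi 1) ring_quot_mul.
Proof. by move=> x; rewrite -[x]ring_piP ring_piM mul1r. Qed.
Fact ring_quot_mul1r : right_id (ring_pi 1) ring_quot_mul.
Proof. by move=> x; rewrite -[x]ring_piP ring_piM mulr1. Qed.
Fact ring_quot_mulDl : left_distributive ring_quot_mul +%R.
Proof.
move=> x y z; rewrite -[x]ring_piP -[y]ring_piP -[z]ring_piP.
by rewrite -ring_piD !ring_piM -ring_piD mulrDl.
Qed.
Fact ring_quot_mulDr : right_distributive ring_quot_mul +%R.
Proof.
move=> x y z; rewrite -[x]ring_piP -[y]ring_piP -[z]ring_piP.
by rewrite -ring_piD !ring_piM -ring_piD mulrDr.
Qed.

HB.instance Definition _ := GRing.Zmodule_isPzRing.Build (ring_quot J)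
  ring_quot_mulA ring_quot_mul1l ring_quot_mul1r
  ring_quot_mulDl ring_quot_mulDr.

Fact ring_pi_zmod : zmod_morphism ring_pi.
Proof. exact: (raddfB \pi_{quot J}). Qed.
HB.instance Definition _ :=
  GRing.isZmodMorphism.Build R (ring_quot J) ring_pi ring_pi_zmod.

Fact ring_pi_monoid : monoid_morphism ring_pi.
Proof. by split=> // x y; apply/esym/ring_piM. Qed.
HB.instance Definition _ :=
  GRing.isMonoidMorphism.Build R (ring_quot J) ring_pi ring_pi_monoid.

End QuotientRing.

Section Idealizer.
Variables (S : pzRingType) (I : submodClosed S^o).

Definition idl_pred : {pred S} :=
  [pred p : S | `[< forall q : S, q \in I -> q * p \in I >]].

Lemma idl_predP (p : S) :
  reflect (forall q : S, q \in I -> q * p \in I) (p \in idl_pred).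
Proof. exact: asboolP. Qed.

Fact idl_subring : subring_closed idl_pred.
Proof.
split=> [|p r /idl_predP pI /idl_predP rI|p r /idl_predP pI /idl_predP rI].
- by apply/idl_predP => q qI; rewrite mulr1.
- apply/idl_predP => q qI; rewrite mulrBr.
  exact: (@rpredB S^o (submod_pred I) _ _ (pI q qI) (rI q qI)).
- by apply/idl_predP => q qI; rewrite mulrA rI ?pI.
Qed.

HB.instance Definition _ := GRing.isSubringClosed.Build S idl_pred idl_subring.

Record idl := Idl { idl_val : S; idl_valP : idl_val \in idl_pred }.
HB.instance Definition _ := [isSub for idl_val].
HB.instance Definition _ := [Choice of idl by <:].
HB.instance Definition _ := 
  GRing.SubChoice_isSubPzRing.Build S idl_pred idl idl_subring.

Definition idl_ideal_pred : {pred idl} := [pred p : idl | idl_val p \in I].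

Fact idl_ideal_zmod : zmod_closed idl_ideal_pred.
Proof.
split=> [|p q pI qI]; first exact: (@rpred0 S^o I).
exact: (@rpredB S^o (submod_pred I) _ _ pI qI).
Qed.

HB.instance Definition _ :=
  GRing.isZmodClosed.Build idl idl_ideal_pred idl_ideal_zmod.

Fact idl_ideal_mull (r x : idl) :
  x \in idl_ideal_pred -> r * x \in idl_ideal_pred.
Proof. exact: (@rpredZ S S^o I). Qed.

Fact idl_ideal_mulr (x r : idl) :
  x \in idl_ideal_pred -> x * r \in idl_ideal_pred.
Proof. exact: (idl_predP _ (idl_valP r)). Qed.

(* [I] seen inside [idl I] *)
Definition idl_ideal : two_sided_ideal idl :=
  TwoSidedIdeal idl_ideal_mull idl_ideal_mulr.

End Idealizer.

Record sigma_derivation (A : nzRingType) (n : nat)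
    (sigma : {rmorphism A -> 'M[A]_n}) := SigmaDerivation {
  sder_val :> 'I_n -> {additive A -> A};
  sderM : forall (i : 'I_n) (a b : A),
    sder_val i (a * b) =
      \sum_(j < n) sigma a i j * sder_val j b + sder_val i a * b
}.

Lemma sder1 (A : nzRingType) (n : nat) (sigma : {rmorphism A -> 'M[A]_n})
    (delta : sigma_derivation sigma) (i : 'I_n) :
  delta i 1 = 0.
Proof.
have := sderM delta i 1 1; rewrite mulr1 rmorph1.
rewrite (bigD1 i) //= big1 => [|j ne_ji]; last first.
  by rewrite mxE eq_sym (negPf ne_ji) mul0r.
by rewrite mxE eqxx mul1r addr0 mulr1 -{1}[delta i 1]addr0 => /addrI.
Qed.

(* The free left [A]-module on the words in the variables; the word
   [[:: i1; ..; ik]] stands for [t_i1 ... t_ik]. *)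
Definition ore (A : nzRingType) (n : nat) (sigma : {rmorphism A -> 'M[A]_n})
  (delta : sigma_derivation sigma) : Type := {malg A[seq 'I_n]}.

Section FreeModule.
Variables (K : choiceType) (A : nzRingType) (V : zmodType).

Lemma malg_sum_w (F : K -> {additive A -> V}) (d : {fset K})
    (p : {malg A[K]}) : (msupp p `<=` d)%fset ->
  \sum_(m <- msupp p) F m p@_m = \sum_(m <- d) F m p@_m.
Proof.
move=> le_pd; apply: big_fset_incl => // m _ /mcoeff_outdom ->.
by rewrite raddf0.
Qed.

Lemma malg_sum_zmod (F : K -> {additive A -> V}) :
  zmod_morphism (fun p : {malg A[K]} => \sum_(m <- msupp p) F m p@_m).
Proof.
move=> p q; set d := (msupp p `|` msupp q)%fset.
rewrite (malg_sum_w F (msuppB_le p q)).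
rewrite (malg_sum_w F (fsubsetUl (msupp p) (msupp q))).
rewrite (malg_sum_w F (fsubsetUr (msupp p) (msupp q))) -sumrB.
by apply: eq_bigr => m _; rewrite !raddfB.
Qed.

Lemma malg_sumU (F : K -> {additive A -> V}) (c : A) (k : K) :
  \sum_(m <- msupp << c *g k >>) F m << c *g k >>@_m = F k c.
Proof. by rewrite (malg_sum_w F msuppU_le) big_seq_fset1 mcoeffUU. Qed.

Lemma malg_additive_ext (f g : {additive {malg A[K]} -> V}) :
  (forall c k, f << c *g k >> = g << c *g k >>) -> f =1 g.
Proof.
move=> eqfg p; rewrite [p]monalgE !raddf_sum.
by apply: eq_bigr => k _; apply: eqfg.
Qed.

End FreeModule.

Section OreExtension.
Variables (A : nzRingType) (n : nat) (sigma : {rmorphism A -> 'M[A]_n}).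
Variable delta : sigma_derivation sigma.

Local Notation S := (ore delta).
Local Notation F := {malg A[seq 'I_n]}.

HB.instance Definition _ := GRing.Lmodule.on S.

(* [t_i (a m)], computed by moving [a] to the left of [t_i] *)
Definition ore_lmulX_mono (i : 'I_n) (m : seq 'I_n) (a : A) : F :=
  \sum_(j < n) << sigma a i j *g j :: m >> + << delta i a *g m >>.

Definition ore_lmulX (i : 'I_n) (p : F) : F :=
  \sum_(m <- msupp p) ore_lmulX_mono i m p@_m.

Definition ore_lmul_word (m : seq 'I_n) (q : F) : F := foldr ore_lmulX q m.

(* (sum_m a_m m) q = sum_m a_m (m q) *)
Definition ore_mul (p q : F) : F :=
  \sum_(m <- msupp p) p@_m *: ore_lmul_word m q.

Definition oreC (a : A) : S := (<< a *g [::] >> : F).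
Definition oreX (i : 'I_n) : S := (<< 1 *g [:: i] >> : F).

Fact ore_lmulX_mono_zmod i m : zmod_morphism (ore_lmulX_mono i m).
Proof.
move=> a b; rewrite /ore_lmulX_mono !raddfB opprD addrACA -sumrB.
by congr (_ + _); apply: eq_bigr => j _; rewrite !mxE raddfB.
Qed.
HB.instance Definition _ i m := GRing.isZmodMorphism.Build A F
  (ore_lmulX_mono i m) (ore_lmulX_mono_zmod i m).

Fact ore_lmulX_zmod i : zmod_morphism (ore_lmulX i).
Proof. exact: (malg_sum_zmod (ore_lmulX_mono i)). Qed.
HB.instance Definition _ i :=
  GRing.isZmodMorphism.Build F F (ore_lmulX i) (ore_lmulX_zmod i).

Lemma ore_lmulXU i a m :
  ore_lmulX i << a *g m >> =
    \sum_(j < n) << sigma a i j *g j :: m >> + << delta i a *g m >>.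
Proof. exact: (malg_sumU (ore_lmulX_mono i)). Qed.

Lemma ore_lmul_cons i m q :
  ore_lmul_word (i :: m) q = ore_lmulX i (ore_lmul_word m q).
Proof. by []. Qed.

Fact ore_lmul_word_zmod m : zmod_morphism (ore_lmul_word m).
Proof.
by elim: m => [|i m IHm] p q //; rewrite !ore_lmul_cons IHm raddfB.
Qed.
HB.instance Definition _ m :=
  GRing.isZmodMorphism.Build F F (ore_lmul_word m) (ore_lmul_word_zmod m).

Definition ore_scale (q : F) (m : seq 'I_n) (a : A) : F :=
  a *: ore_lmul_word m q.
Fact ore_scale_zmod q m : zmod_morphism (ore_scale q m).
Proof. by move=> a b; apply: scalerBl. Qed.
HB.instance Definition _ q m :=
  GRing.isZmodMorphism.Build A F (ore_scale q m) (ore_scale_zmod q m).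

Definition ore_mulr (q p : F) : F := ore_mul p q.
Fact ore_mulr_zmod q : zmod_morphism (ore_mulr q).
Proof. exact: (malg_sum_zmod (ore_scale q)). Qed.
HB.instance Definition _ q :=
  GRing.isZmodMorphism.Build F F (ore_mulr q) (ore_mulr_zmod q).

Fact ore_mul_zmod p : zmod_morphism (ore_mul p).
Proof.
move=> q r; rewrite /ore_mul -sumrB.
by apply: eq_bigr => m _; rewrite raddfB scalerBr.
Qed.
HB.instance Definition _ p :=
  GRing.isZmodMorphism.Build F F (ore_mul p) (ore_mul_zmod p).

Lemma ore_mulU a m q : ore_mul << a *g m >> q = a *: ore_lmul_word m q.
Proof. exact: (malg_sumU (ore_scale q)). Qed.

Lemma malgZU (a b : A) (m : seq 'I_n) :
  a *: (<< b *g m >> : F) = << a * b *g m >>.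
Proof. by apply/malgP=> k; rewrite mcoeffZ !mcoeffU mulrnAr. Qed.

Lemma ore_lmulX1 i m : ore_lmulX i << 1 *g m >> = << 1 *g i :: m >>.
Proof.
rewrite ore_lmulXU sder1 raddf0 addr0 rmorph1 (bigD1 i) //= big1 => [|j ne_ji].
  by rewrite mxE eqxx addr0.
by rewrite mxE eq_sym (negPf ne_ji) raddf0.
Qed.

Lemma ore_lmul_word1 m k : ore_lmul_word m << 1 *g k >> = << 1 *g m ++ k >>.
Proof. by elim: m => // i m IHm; rewrite ore_lmul_cons IHm ore_lmulX1. Qed.

Lemma ore_lmulXZ i a (p : F) :
  ore_lmulX i (a *: p) =
    \sum_(j < n) sigma a i j *: ore_lmulX j p + delta i a *: p.
Proof.
pose f1 (q : F) : F := ore_lmulX i (a *: q).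
pose f2 (q : F) : F :=
  \sum_(j < n) sigma a i j *: ore_lmulX j q + delta i a *: q.
have f1z : zmod_morphism f1 by move=> x y; rewrite /f1 scalerBr raddfB.
have f2z : zmod_morphism f2.
  move=> x y; rewrite /f2 opprD addrACA; congr (_ + _); last exact: scalerBr.
  by rewrite -sumrB; apply: eq_bigr => j _; rewrite raddfB; apply: scalerBr.
pose g1 := GRing.isZmodMorphism.Build F F f1 f1z.
pose g2 := GRing.isZmodMorphism.Build F F f2 f2z.
pose h1 : {additive F -> F} := HB.pack f1 g1.
pose h2 : {additive F -> F} := HB.pack f2 g2.
suff e : h1 =1 h2 by apply: e.
apply: malg_additive_ext => b m; rewrite /= /f1 /f2 !malgZU ore_lmulXU sderM.
rewrite raddfD /= addrA raddf_sum /=.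
under [X in _ = X + _]eq_bigr do rewrite ore_lmulXU scalerDr scaler_sumr malgZU.
rewrite big_split /=; congr (_ + _ + _).
rewrite exchange_big /=; apply: eq_bigr => k _.
rewrite rmorphM mxE raddf_sum /=; apply: eq_bigr => j _.
by rewrite malgZU.
Qed.

Lemma ore_mulZl a p q : ore_mul (a *: p) q = a *: ore_mul p q.
Proof.
pose f1 (x : F) : F := ore_mul (a *: x) q.
pose f2 (x : F) : F := a *: ore_mul x q.
have f1z : zmod_morphism f1.
  by move=> x y; rewrite /f1 scalerBr; apply: (raddfB (ore_mulr q)).
have f2z : zmod_morphism f2.
  move=> x y; rewrite /f2 -scalerBr; congr (_ *: _).
  exact: (raddfB (ore_mulr q)).
pose g1 := GRing.isZmodMorphism.Build F F f1 f1z.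
pose g2 := GRing.isZmodMorphism.Build F F f2 f2z.
pose h1 : {additive F -> F} := HB.pack f1 g1.
pose h2 : {additive F -> F} := HB.pack f2 g2.
suff e : h1 =1 h2 by apply: e.
apply: malg_additive_ext => b m.
by rewrite /= /f1 /f2 malgZU !ore_mulU scalerA.
Qed.

Lemma ore_lmulX_mul i p q : ore_mul (ore_lmulX i p) q = ore_lmulX i (ore_mul p q).
Proof.
pose f1 (x : F) : F := ore_mulr q (ore_lmulX i x).
pose f2 (x : F) : F := ore_lmulX i (ore_mulr q x).
have f1z : zmod_morphism f1 by move=> x y; rewrite /f1 !raddfB.
have f2z : zmod_morphism f2 by move=> x y; rewrite /f2 !raddfB.
pose g1 := GRing.isZmodMorphism.Build F F f1 f1z.
pose g2 := GRing.isZmodMorphism.Build F F f2 f2z.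
pose h1 : {additive F -> F} := HB.pack f1 g1.
pose h2 : {additive F -> F} := HB.pack f2 g2.
suff e : h1 =1 h2 by apply: e.
apply: malg_additive_ext => b m.
rewrite /= /f1 /f2 ore_lmulXU raddfD raddf_sum /= /ore_mulr !ore_mulU.
rewrite ore_lmulXZ; congr (_ + _); apply: eq_bigr => j _.
by rewrite ore_mulU.
Qed.

Lemma ore_lmul_word_mul m p q :
  ore_mul (ore_lmul_word m p) q = ore_lmul_word m (ore_mul p q).
Proof. by elim: m => // i m IHm; rewrite !ore_lmul_cons ore_lmulX_mul IHm. Qed.

Fact ore_mulA : associative ore_mul.
Proof.
move=> p q r.
pose f1 (x : F) : F := ore_mulr (ore_mul q r) x.
pose f2 (x : F) : F := ore_mulr r (ore_mulr q x).
have f2z : zmod_morphism f2 by move=> x y; rewrite /f2 !raddfB.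
pose g2 := GRing.isZmodMorphism.Build F F f2 f2z.
pose h2 : {additive F -> F} := HB.pack f2 g2.
suff e : ore_mulr (ore_mul q r) =1 h2 by apply: e.
apply: malg_additive_ext => b m.
by rewrite /= /f2 /ore_mulr !ore_mulU ore_mulZl ore_lmul_word_mul.
Qed.

Fact ore_mul1l : left_id (oreC 1) ore_mul.
Proof. by move=> p; rewrite /oreC ore_mulU scale1r. Qed.

Fact ore_mul1r : right_id (oreC 1) ore_mul.
Proof.
suff e : ore_mulr (oreC 1) =1 @idfun F by apply: e.
apply: malg_additive_ext => b m.
by rewrite /= /ore_mulr ore_mulU ore_lmul_word1 malgZU mulr1 cats0.
Qed.

Fact ore_mulDl : left_distributive ore_mul +%R.
Proof. by move=> p q r; apply: (raddfD (ore_mulr r)). Qed.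

Fact ore_mulDr : right_distributive ore_mul +%R.
Proof. by move=> p q r; apply: (raddfD (ore_mul p)). Qed.

Fact ore_nonzero1 : oreC 1 != 0.
Proof. by rewrite /oreC (@monalgU_eq0 (seq 'I_n) A) oner_eq0. Qed.

HB.instance Definition _ := GRing.Zmodule_isNzRing.Build S
  ore_mulA ore_mul1l ore_mul1r ore_mulDl ore_mulDr ore_nonzero1.

Fact oreC_zmod : zmod_morphism oreC.
Proof. by move=> a b; apply: (monalgUB [::]). Qed.
HB.instance Definition _ :=
  GRing.isZmodMorphism.Build A S oreC oreC_zmod.

Lemma oreCM_scale (a : A) (p : S) : oreC a * p = a *: p.
Proof. exact: ore_mulU. Qed.

Fact oreC_monoid : monoid_morphism oreC.
Proof. by split=> // a b; rewrite oreCM_scale; apply/esym/malgZU. Qed.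
HB.instance Definition _ :=
  GRing.isMonoidMorphism.Build A S oreC oreC_monoid.

Lemma oreXM (i : 'I_n) (p : S) : oreX i * p = ore_lmulX i p.
Proof. by rewrite [LHS]ore_mulU scale1r. Qed.

Lemma ore_rule (i : 'I_n) (a : A) :
  oreX i * oreC a =
    \sum_(j < n) oreC (sigma a i j) * oreX j + oreC (delta i a).
Proof.
rewrite oreXM ore_lmulXU; congr (_ + _); apply: eq_bigr => j _.
by rewrite oreCM_scale malgZU mulr1.
Qed.

Lemma ore_word (m : seq 'I_n) :
  \prod_(i <- m) oreX i = (<< 1 *g m >> : F) :> S.
Proof.
elim: m => [|i m IHm]; first by rewrite big_nil.
by rewrite big_cons IHm oreXM ore_lmulX1.
Qed.

Lemma oreE (p : S) :
  p = \sum_(m <- msupp (p : F)) oreC (p : F)@_m * \prod_(i <- m) oreX i.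
Proof.
rewrite [LHS](@monalgE (seq 'I_n) A); apply: eq_bigr => m _.
by rewrite ore_word oreCM_scale malgZU mulr1.
Qed.

End OreExtension.

Section Centralizer.
Variables (A : nzRingType) (n : nat) (sigma : {rmorphism A -> 'M[A]_n}).
Variables (delta : sigma_derivation sigma) (a : 'cV[A]_n).

Definition centr_pred : {pred A} :=
  [pred x : A | sigma x *m a + \col_i delta i x == \col_i (a i 0 * x)].

Fact centr_subring : subring_closed centr_pred.
Proof.
split=> [|x y /eqP ex /eqP ey|x y /eqP ex /eqP ey]; rewrite inE.
- rewrite rmorph1 mul1mx; apply/eqP/matrixP=> i j.
  by rewrite !mxE sder1 addr0 mulr1 ord1.
- rewrite raddfB /= mulmxBl; apply/eqP.
  transitivity ((sigma x *m a + \col_i delta i x)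
                 - (sigma y *m a + \col_i delta i y)).
    rewrite opprD addrACA; congr (_ + _).
    by apply/matrixP=> i j; rewrite !mxE raddfB.
  by rewrite ex ey; apply/matrixP=> i j; rewrite !mxE mulrBr.
- apply/eqP; rewrite rmorphM /= -mulmxA.
  have -> : sigma y *m a = \col_i (a i 0 * y) - \col_i delta i y.
    by rewrite -ey addrK.
  apply/matrixP=> i j; have /matrixP/(_ i 0) := ex; rewrite !mxE => ei.
  rewrite sderM mulrA -ei mulrDl mulr_suml addrA -big_split /=.
  congr (_ + _); apply: eq_bigr => k _.
  by rewrite !mxE mulrBr subrK mulrA.
Qed.

HB.instance Definition _ :=
  GRing.isSubringClosed.Build A centr_pred centr_subring.

Record centr := Centr { centr_val : A; centr_valP : centr_val \in centr_pred }.
HB.instance Definition _ := [isSub for centr_val].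
HB.instance Definition _ := [Choice of centr by <:].
HB.instance Definition _ := [SubChoice_isSubNzRing of centr by <:].

Local Notation S := (ore delta).

Definition ore_ideal : {pred S^o} :=
  [pred p : S | `[< exists q : 'I_n -> S,
     p = \sum_(i < n) q i * (oreX delta i - oreC delta (a i 0)) >]].

Fact ore_ideal_submod : submod_closed ore_ideal.
Proof.
split=> [|r p q /asboolP[f ->] /asboolP[g ->]]; apply/asboolP.
  by exists (fun=> 0); rewrite big1 // => i _; rewrite mul0r.
exists (fun i => r * f i + g i).
under [RHS]eq_bigr do rewrite mulrDl -mulrA.
by rewrite big_split -mulr_sumr.
Qed.

HB.instance Definition _ :=
  GRing.isSubmodClosed.Build S S^o ore_ideal ore_ideal_submod.

End Centralizer.

Arguments ore_ideal {A n sigma} delta a.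

(* Main.v *)
(* Evaluating [t_i] at [a_i] through the pseudo-linear maps
   [T_i x = sum_j sigma_ij(x) a_j + delta_i(x)] ([plt i]) turns [A] into a left
   [S]-module, and [p |-> p.1] ([ore_ev]) is an additive retraction of
   [A -> S] with kernel exactly [I]; thus [S = A + I] is a direct sum.  Every
   endomorphism of [S/I] is right multiplication by an element of [idl(I)],
   unique modulo [I], hence by a unique element of [A] lying in [idl(I)]; and
   [b] in [A] lies in [idl(I)] iff [T_i b = a_i b] for all [i], i.e. iff [b] is
   in the centralizer. *)
Require Import Defs.
From HB Require Import structures.
From mathcomp Require Import all_boot all_algebra.
From mathcomp Require Import finmap boolp.
From mathcomp Require Import monalg.

Set Implicit Arguments.
Unset Strict Implicit.
Unset Printing Implicit Defensive.

Import GRing.Theory.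
Local Open Scope ring_scope.

(** * Ring isomorphisms *)

Lemma ring_iso_division (R1 R2 : pzRingType) :
  ring_iso R1 R2 -> is_division_ring R1 -> is_division_ring R2.
Proof.
move=> [f [g fK gK]] [R1_neq0 invR1]; split=> [|y y_neq0].
  apply: contra_neq R1_neq0 => e.
  by rewrite -[LHS]fK -[RHS]fK rmorph1 e rmorph0.
have [|x [gyx xgy]] := invR1 (g y).
  by apply: contra_neq y_neq0 => e; rewrite -[y]gK e rmorph0.
by exists (f x); rewrite -[y]gK -!rmorphM gyx xgy rmorph1.
Qed.

Lemma rmorph_bij_iso (R1 R2 : pzRingType) (f : {rmorphism R1 -> R2}) :
  injective f -> (forall y, exists x, f x = y) -> ring_iso R1 R2.
Proof.
move=> f_inj f_surj; exists f.
have [g gK] := choice f_surj.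
by exists g => // x; apply: f_inj; rewrite gK.
Qed.

Lemma ring_iso_sym (R1 R2 : pzRingType) : ring_iso R1 R2 -> ring_iso R2 R1.
Proof.
move=> [f [g fK gK]].
have gB : zmod_morphism g.
  by move=> x y; rewrite -{1}[x]gK -{1}[y]gK -rmorphB fK.
have gM : monoid_morphism g.
  split=> [|x y]; first by rewrite -(rmorph1 f) fK.
  by rewrite -{1}[x]gK -{1}[y]gK -rmorphM fK.
pose gZ := GRing.isZmodMorphism.Build R2 R1 g gB.
pose gR := GRing.isMonoidMorphism.Build R2 R1 g gM.
pose h : {rmorphism R2 -> R1} := HB.pack g gZ gR.
by exists h, f.
Qed.

(** * First isomorphism theorem for noncommutative rings *)

Section FirstIsomorphism.
Variables (R R' : pzRingType) (f : {rmorphism R -> R'}).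
Variable (J : two_sided_ideal R).
Hypothesis kerf : forall x, f x = 0 <-> x \in J.

Definition quot_map (x : ring_quot J) : R' := f (ring_repr x).

(** The chosen representative differs from [x] by an element of [J], which [f] kills, so the choice
    is immaterial. *)
Lemma quot_mapE (x : R) : quot_map (ring_pi J x) = f x.
Proof.
apply/eqP; rewrite -subr_eq0 -rmorphB; apply/eqP/kerf/ring_pi_eq.
exact: ring_piP.
Qed.

Fact quot_map_zmod : zmod_morphism quot_map.
Proof.
move=> x y; rewrite -[x]ring_piP -[y]ring_piP -raddfB !quot_mapE.
exact: rmorphB.
Qed.
HB.instance Definition _ :=
  GRing.isZmodMorphism.Build (ring_quot J) R' quot_map quot_map_zmod.

Fact quot_map_monoid : monoid_morphism quot_map.
Proof.
split=> [|x y]; first by rewrite -[1]/(ring_pi J 1) quot_mapE rmorph1.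
by rewrite -[x]ring_piP -[y]ring_piP -rmorphM !quot_mapE rmorphM.
Qed.
HB.instance Definition _ :=
  GRing.isMonoidMorphism.Build (ring_quot J) R' quot_map quot_map_monoid.

(** The inclusion of [J] in the kernel made the map well defined; the reverse inclusion makes it
    injective. *)
Lemma quot_iso : (forall y, exists x, f x = y) -> ring_iso (ring_quot J) R'.
Proof.
move=> f_surj; apply: (@rmorph_bij_iso _ _ quot_map) => [x y|y].
  rewrite -[x]ring_piP -[y]ring_piP /= !quot_mapE => /eqP.
  by rewrite -subr_eq0 -rmorphB => /eqP/kerf/ring_pi_eq.
by have [x <-] := f_surj y; exists (ring_pi J x); apply: quot_mapE.
Qed.

End FirstIsomorphism.

(** * Endomorphisms of [S/I] and the idealizer, for any left ideal [I] *)

Section RightMultiplication.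
Variables (S : pzRingType) (I : submodClosed S^o).

Local Notation SI := (mod_quot I).

Definition idl_rmul_fun (p : idl I) (x : SI) : SI :=
  mod_pi I (mod_repr x * idl_val p).

(** Two representatives differ by an element of [I], and [I p] stays in [I] by definition of the
    idealizer. *)
Lemma idl_rmul_funE (p : idl I) (q : S) :
  idl_rmul_fun p (mod_pi I q) = mod_pi I (q * idl_val p).
Proof.
apply/mod_pi_eq; rewrite -mulrBl; apply: (idl_predP _ _ (idl_valP p)).
by apply/mod_pi_eq; apply: mod_piP.
Qed.

Fact idl_rmul_zmod p : zmod_morphism (idl_rmul_fun p).
Proof.
move=> x y; rewrite -[x]mod_piP -[y]mod_piP -raddfB !idl_rmul_funE.
by rewrite mulrBl raddfB.
Qed.
HB.instance Definition _ p :=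
  GRing.isZmodMorphism.Build SI SI (idl_rmul_fun p) (idl_rmul_zmod p).

Fact idl_rmul_scalable p : scalable (idl_rmul_fun p).
Proof.
move=> r x; rewrite -[x]mod_piP -linearZ !idl_rmul_funE -linearZ.
by congr (mod_pi I _); rewrite /GRing.scale /= mulrA.
Qed.
HB.instance Definition _ p :=
  GRing.isScalable.Build S SI SI *:%R (idl_rmul_fun p) (idl_rmul_scalable p).

Definition idl_rmul (p : idl I) : lend SI := idl_rmul_fun p : {linear SI -> SI}.

Lemma idl_rmulE (p : idl I) (q : S) :
  lend_fun (idl_rmul p) (mod_pi I q) = mod_pi I (q * idl_val p).
Proof. exact: idl_rmul_funE. Qed.

Lemma lend_quotP (f g : lend SI) :
  (forall q : S, lend_fun f (mod_pi I q) = lend_fun g (mod_pi I q)) -> f = g.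
Proof. by move=> fg; apply: lendP => x; rewrite -[x]mod_piP. Qed.

Fact idl_rmul_additive : zmod_morphism idl_rmul.
Proof.
move=> p r; apply: lend_quotP => q; rewrite idl_rmulE.
(* Simplification unfolds the difference of endomorphisms down to raw functions, which are folded
   back for [idl_rmulE]. *)
rewrite [RHS]/= -[idl_rmul_fun p _]/(lend_fun (idl_rmul p) _).
rewrite -[idl_rmul_fun r _]/(lend_fun (idl_rmul r) _).
by rewrite !idl_rmulE -raddfB -mulrBr.
Qed.
HB.instance Definition _ :=
  GRing.isZmodMorphism.Build (idl I) (lend SI) idl_rmul idl_rmul_additive.

(** The product of [lend] applies its left factor first, and [(q p) r = q (p r)]; the usual order of
    composition would give an anti-morphism. *)
Fact idl_rmul_monoid : monoid_morphism idl_rmul.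
Proof.
split=> [|p r]; apply: lend_quotP => q; rewrite idl_rmulE.
  by rewrite [in LHS]/= mulr1.
rewrite -[RHS]/(lend_fun (idl_rmul r) (lend_fun (idl_rmul p) _)).
by rewrite !idl_rmulE mulrA.
Qed.
HB.instance Definition _ :=
  GRing.isMonoidMorphism.Build (idl I) (lend SI) idl_rmul idl_rmul_monoid.

(** Evaluate at the class of 1 for one direction; for the other, [S p] lies in the left ideal
    [I]. *)
Lemma idl_rmul_eq0 (p : idl I) : idl_rmul p = 0 <-> idl_val p \in I.
Proof.
split=> [p0|pI].
  have := idl_rmulE p 1; rewrite p0 mul1r => e.
  by rewrite -[idl_val p]subr0; apply/mod_pi_eq; rewrite -e raddf0.
apply: lend_quotP => q; rewrite idl_rmulE.
transitivity (mod_pi I 0); last by rewrite raddf0.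
by apply/mod_pi_eq; rewrite subr0; apply: (@rpredZ S S^o I).
Qed.

(** The class of 1 generates [S/I], so linearity determines [f] from its value there. *)
Lemma lend_mod_pi (f : lend SI) (p : S) :
  mod_pi I p = lend_fun f (mod_pi I 1) ->
  forall q : S, lend_fun f (mod_pi I q) = mod_pi I (q * p).
Proof.
move=> fp q; rewrite -{1}[q]mulr1 -[q * 1]/(q *: (1 : S^o)) linearZ /=.
by rewrite linearZ /= -fp -linearZ.
Qed.

(** Take [p] representing the image of 1: for [q] in [I], the class of [q p] is the image under [f]
    of the zero class, so [p] idealizes [I]. *)
Lemma idl_rmul_surj (f : lend SI) : exists p : idl I, idl_rmul p = f.
Proof.
pose p : S := mod_repr (lend_fun f (mod_pi I 1)).
have fE := lend_mod_pi (mod_piP _ : mod_pi I p = _).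
have pP : p \in idl_pred I.
  apply/idl_predP => q qI; rewrite -[q * p]subr0; apply/mod_pi_eq.
  have q0 : mod_pi I q = mod_pi I 0 by apply/mod_pi_eq; rewrite subr0.
  by rewrite -fE q0 !raddf0.
by exists (Idl pP); apply: lend_quotP => q; rewrite idl_rmulE fE.
Qed.

Lemma lend_idl_iso : ring_iso (lend SI) (ring_quot (idl_ideal I)).
Proof.
apply: ring_iso_sym; apply: (@quot_iso _ _ idl_rmul).
  exact: idl_rmul_eq0.
exact: idl_rmul_surj.
Qed.

End RightMultiplication.

(** For [f] the embedding [oreC], [X] the variables and [s j = sigma x i j], this writes
    [t_i x - T_i x] as a left combination of the [t_j - a_j]. *)
Lemma rmorph_linear_form_sub (R R' : pzRingType) (f : {rmorphism R -> R'})
    (n : nat) (X : 'I_n -> R') (s a : 'I_n -> R) (d : R) :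
  \sum_(j < n) f (s j) * X j + f d - f (\sum_(j < n) s j * a j + d) =
    \sum_(j < n) f (s j) * (X j - f (a j)).
Proof.
rewrite rmorphD opprD addrACA subrr addr0 rmorph_sum -sumrB.
by apply: eq_bigr => j _; rewrite rmorphM -mulrBr.
Qed.

(** * Pseudo-linear maps and evaluation at [a] *)

Section Evaluation.
Variables (A : nzRingType) (n : nat) (sigma : {rmorphism A -> 'M[A]_n}).
Variables (delta : sigma_derivation sigma) (a : 'cV[A]_n).

Local Notation S := (ore delta).
Local Notation F := {malg A[seq 'I_n]}.
Local Notation I := (ore_ideal delta a).

Definition plt (i : 'I_n) (x : A) : A :=
  \sum_(j < n) sigma x i j * a j 0 + delta i x.

Fact plt_zmod i : zmod_morphism (plt i).
Proof.
move=> x y; rewrite /plt !raddfB opprD addrACA -sumrB; congr (_ + _).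
by apply: eq_bigr => j _; rewrite !mxE mulrBl.
Qed.
HB.instance Definition _ i :=
  GRing.isZmodMorphism.Build A A (plt i) (plt_zmod i).

(** Same shape as the rule for [t_i x]: this is what lets [t_i] act on [A] as [plt i]. *)
Lemma pltM i x y :
  plt i (x * y) = \sum_(j < n) sigma x i j * plt j y + delta i x * y.
Proof.
rewrite /plt sderM rmorphM addrA; congr (_ + _).
under [RHS]eq_bigr do rewrite mulrDr.
rewrite big_split /=; congr (_ + _).
under [RHS]eq_bigr do rewrite mulr_sumr.
rewrite exchange_big /=; apply: eq_bigr => k _.
by rewrite mxE mulr_suml; apply: eq_bigr => j _; rewrite mulrA.
Qed.

Lemma plt1 i : plt i 1 = a i 0.
Proof.
rewrite /plt sder1 addr0 rmorph1 (bigD1 i) //= big1 => [|j ne_ji].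
  by rewrite mxE eqxx mul1r addr0.
by rewrite mxE eq_sym (negPf ne_ji) mul0r.
Qed.

Lemma centrP (b : A) :
  reflect (forall i, plt i b = a i 0 * b) (b \in centr_pred delta a).
Proof.
apply: (iffP eqP) => [/matrixP e i|e].
  by have := e i 0; rewrite !mxE.
by apply/matrixP=> i j; rewrite !mxE -e ord1.
Qed.

(** The monomial [x m] acting on 1, where a word acts as the composite of the maps [plt]. *)
Definition ev_mono (m : seq 'I_n) (x : A) : A := x * foldr plt 1 m.
Fact ev_mono_zmod m : zmod_morphism (ev_mono m).
Proof. by move=> x y; apply: mulrBl. Qed.
HB.instance Definition _ m :=
  GRing.isZmodMorphism.Build A A (ev_mono m) (ev_mono_zmod m).

Definition ore_ev (p : S) : A :=
  \sum_(m <- msupp (p : F)) ev_mono m (p : F)@_m.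

Fact ore_ev_zmod : zmod_morphism ore_ev.
Proof. exact: (malg_sum_zmod ev_mono). Qed.
HB.instance Definition _ := GRing.isZmodMorphism.Build S A ore_ev ore_ev_zmod.

Lemma ore_evU x m : ore_ev (<< x *g m >> : F) = x * foldr plt 1 m.
Proof. exact: (malg_sumU ev_mono). Qed.

Lemma ore_evC x : ore_ev (oreC delta x) = x.
Proof. by rewrite /oreC ore_evU mulr1. Qed.

Lemma ore_ind_mono (P : S -> Prop) :
  (forall p q, P p -> P q -> P (p + q)) ->
  (forall c m, P (<< c *g m >> : F)) -> forall p, P p.
Proof.
move=> PD PU p; rewrite [p](@monalgE (seq 'I_n) A).
(* The empty sum is treated as a monomial with coefficient 0. *)
by apply: big_ind => //; rewrite -(monalgU0 [::]).
Qed.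

(** Each monomial arises from 1 by left multiplication by variables, then by a constant. *)
Lemma ore_ind (P : S -> Prop) :
  (forall p q, P p -> P q -> P (p + q)) ->
  (forall x p, P p -> P (oreC delta x * p)) ->
  (forall i p, P p -> P (oreX delta i * p)) ->
  P 1 -> forall p, P p.
Proof.
move=> PD PC PX P1; apply: ore_ind_mono => // c m.
rewrite -[c]mulr1 -malgZU -(ore_word delta) -oreCM_scale; apply: PC.
by elim: m => [|i m IHm]; rewrite ?big_nil ?big_cons //; apply: PX.
Qed.

Lemma ore_evCM x p : ore_ev (oreC delta x * p) = x * ore_ev p.
Proof.
elim/ore_ind_mono: p => [p q IHp IHq|c m].
  by rewrite mulrDr !raddfD /= IHp IHq mulrDr.
by rewrite oreCM_scale malgZU !ore_evU mulrA.
Qed.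

(** On a monomial [c m], expanding [t_i c] matches [pltM] term by term. *)
Lemma ore_evXM i p : ore_ev (oreX delta i * p) = plt i (ore_ev p).
Proof.
elim/ore_ind_mono: p => [p q IHp IHq|c m].
  by rewrite mulrDr !raddfD /= IHp IHq.
rewrite oreXM ore_lmulXU (@raddfD S A ore_ev) (@raddf_sum S A ore_ev).
rewrite /= !ore_evU pltM; congr (_ + _).
by apply: eq_bigr => j _; rewrite ore_evU.
Qed.

(** Constants and variables preserve the kernel of [ore_ev], which is therefore a left ideal. *)
Lemma ore_evM_eq0 p q : ore_ev q = 0 -> ore_ev (p * q) = 0.
Proof.
move=> q0; elim/ore_ind: p => [p r IHp IHr|x p IHp|i p IHp|].
- by rewrite mulrDl raddfD /= IHp IHr addr0.
- by rewrite -mulrA ore_evCM IHp mulr0.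
- by rewrite -mulrA ore_evXM IHp raddf0.
- by rewrite mul1r.
Qed.

(** * The ideal [I] as the kernel of evaluation *)

Lemma ore_ideal_gen i : (oreX delta i - oreC delta (a i 0)) \in I.
Proof.
apply/asboolP; exists (fun j => (j == i)%:R).
rewrite (bigD1 i) //= eqxx mul1r big1 ?addr0 // => j /negPf->.
by rewrite mul0r.
Qed.

Lemma ore_idealMl p q : q \in I -> p * q \in I.
Proof. exact: (@rpredZ S S^o I). Qed.

Lemma ore_idealD p q : p \in I -> q \in I -> p + q \in I.
Proof. exact: (@rpredD S^o I). Qed.

Lemma ore_evXC i x :
  ore_ev ((oreX delta i - oreC delta (a i 0)) * oreC delta x) =
    plt i x - a i 0 * x.
Proof.
rewrite mulrBl (@raddfB S A ore_ev) /=.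
by congr (_ - _); [rewrite ore_evXM ore_evC | rewrite ore_evCM ore_evC].
Qed.

Lemma sub_ore_ev p : p - oreC delta (ore_ev p) \in I.
Proof.
elim/ore_ind: p => [p q IHp IHq|x p IHp|i p IHp|].
- by rewrite !raddfD addrACA ore_idealD.
- by rewrite ore_evCM rmorphM -mulrBr ore_idealMl.
- rewrite ore_evXM; set y := ore_ev p in IHp *.
  (* Split [t_i p - T_i y] as [t_i (p - y) + (t_i y - T_i y)]: the induction hypothesis handles the
     first term, the [t_j - a_j] generate the second. *)
  rewrite -[_ * p](subrK (oreX delta i * oreC delta y)) -mulrBr -addrA.
  apply: ore_idealD; first exact: ore_idealMl.
  by apply/asboolP; eexists; rewrite ore_rule; apply: rmorph_linear_form_sub.
- by rewrite -(rmorph1 (oreC delta)) ore_evC subrr; apply: (@rpred0 S^o I).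
Qed.

(** Generators evaluate to [T_i 1 - a_i = 0] and the kernel is a left ideal; the converse is
    [sub_ore_ev]. *)
Lemma ore_idealP (p : S) : p \in I <-> ore_ev p = 0.
Proof.
split=> [/asboolP[f ->]|p0].
  rewrite raddf_sum big1 // => i _; apply: ore_evM_eq0.
  rewrite -[X in ore_ev X]mulr1 -(rmorph1 (oreC delta)) ore_evXC.
  by rewrite plt1 mulr1 subrr.
by have := sub_ore_ev p; rewrite p0 raddf0 subr0.
Qed.

(** * The centralizer inside the idealizer, and its action on [S/I] *)

(** By [ore_evXC], the centralizer condition says that each [(t_i - a_i) b] evaluates to 0; left
    multiples then do as well. *)
Lemma oreC_idl (b : A) :
  (oreC delta b \in idl_pred I) = (b \in centr_pred delta a).
Proof.
apply/idl_predP/centrP => [bI i|eb q /asboolP[f ->]].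
  apply/eqP; rewrite -subr_eq0 -ore_evXC; apply/eqP/ore_idealP/bI.
  exact: ore_ideal_gen.
apply/ore_idealP; rewrite mulr_suml raddf_sum big1 // => i _.
by rewrite -mulrA /= ore_evM_eq0 // ore_evXC eb subrr.
Qed.

Fact centr_idl_subproof (b : centr delta a) :
  oreC delta (centr_val b) \in idl_pred I.
Proof. by rewrite oreC_idl centr_valP. Qed.

Definition centr_idl (b : centr delta a) : idl I := Idl (centr_idl_subproof b).

Fact centr_idl_zmod : zmod_morphism centr_idl.
Proof. by move=> b c; apply: val_inj; rewrite /= raddfB. Qed.
HB.instance Definition _ :=
  GRing.isZmodMorphism.Build (centr delta a) (idl I) centr_idl centr_idl_zmod.

Fact centr_idl_monoid : monoid_morphism centr_idl.
Proof.
split=> [|b c]; apply: val_inj; first exact: (rmorph1 (oreC delta)).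
exact: (rmorphM (oreC delta)).
Qed.
HB.instance Definition _ := GRing.isMonoidMorphism.Build
  (centr delta a) (idl I) centr_idl centr_idl_monoid.

(** Serves both as the isomorphism onto the endomorphism ring and as the right action on [S/I]. *)
Definition centr_rmul (b : centr delta a) : lend (mod_quot I) :=
  idl_rmul (centr_idl b).
HB.instance Definition _ :=
  GRing.RMorphism.copy centr_rmul (@idl_rmul S I \o centr_idl).

Lemma centr_lend_iso : ring_iso (centr delta a) (lend (mod_quot I)).
Proof.
apply: (@rmorph_bij_iso _ _ centr_rmul) => [|f].
  (* A constant in [I] equals its own evaluation, hence is 0. *)
  apply: raddf_inj => b /idl_rmul_eq0/ore_idealP/=.
  by rewrite ore_evC => b0; apply: val_inj.
have [p <-] := idl_rmul_surj f.
(* For [q] in [I], both [q p] and [q (p - ore_ev p)] lie in [I], hence so does [q] times the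
   constant [ore_ev p]. *)
have bI : oreC delta (ore_ev (idl_val p)) \in idl_pred I.
  apply/idl_predP => q qI; apply/ore_idealP.
  have /idl_predP/(_ q qI)/ore_idealP qp0 := idl_valP p.
  have /ore_idealP := ore_idealMl q (sub_ore_ev (idl_val p)).
  by rewrite mulrBr raddfB /= qp0 sub0r => /eqP; rewrite oppr_eq0 => /eqP.
have bC : ore_ev (idl_val p) \in centr_pred delta a by rewrite -oreC_idl.
(* [p] and its evaluation agree modulo [I], so they induce the same endomorphism. *)
exists (Centr bC); apply/esym/eqP.
rewrite -subr_eq0 /= /centr_rmul -(@raddfB (idl I)); apply/eqP/idl_rmul_eq0.
exact: sub_ore_ev.
Qed.

(** * Inverses in the centralizer *)

(* [T_i (b c) = T_i 1] and [b] in the centralizer give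
   [sigma b (T c - a c) = 0], where [sigma b] is invertible. *)
Lemma centr_inv (b c : A) : b * c = 1 -> c * b = 1 ->
  b \in centr_pred delta a -> c \in centr_pred delta a.
Proof.
move=> bc cb /centrP bP; apply/centrP.
pose v : 'cV[A]_n := \col_i (plt i c - a i 0 * c).
have bv0 : sigma b *m v = 0.
  apply/matrixP => i j; rewrite !mxE.
  under eq_bigr do rewrite mxE mulrBr mulrA.
  rewrite sumrB -mulr_suml.
  have := pltM i b c; rewrite bc plt1 => e.
  have /eqP := bP i; rewrite {1}/plt -subr_eq0 => /eqP e'.
  apply/eqP; rewrite subr_eq0 eq_sym -(inj_eq (addIr (delta i b * c))) -e.
  by rewrite -mulrDl -/(plt i b) bP -mulrA bc mulr1.
have v0 : v = 0.
  by rewrite -[v]mul1mx -[1%:M](rmorph1 sigma) -cb rmorphM -mulmxA bv0 mulmx0.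
move=> i; have /matrixP/(_ i 0) := v0; rewrite !mxE => vi0.
by apply/eqP; rewrite -subr_eq0 vi0.
Qed.

Lemma centr_division : is_division_ring A -> is_division_ring (centr delta a).
Proof.
move=> [_ invA]; split=> [|b b_neq0]; first exact: oner_neq0.
have [|c [bc cb]] := invA (centr_val b).
  by apply: contra_neq b_neq0 => b0; apply: val_inj.
exists (Centr (centr_inv bc cb (centr_valP b))).
by split; apply: val_inj.
Qed.

End Evaluation.

Theorem proposition5p2 (A : nzRingType) (domA : is_domain A)
    (n : nat) (n_gt0 : (0 < n)%N)
    (sigma : {rmorphism A -> 'M[A]_n}) (delta : sigma_derivation sigma)
    (a : 'cV[A]_n) :
  let S : nzRingType := ore delta in
  let C : nzRingType := centr delta a in
  let I : submodClosed S^o := ore_ideal delta a in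
  let SI : lmodType S := mod_quot I in
  [/\
    forall b : A,
      (b \in centr_pred delta a) <->
      (forall i : 'I_n,
        \sum_(j < n) sigma b i j * a j 0 + delta i b - a i 0 * b = 0),
    (left_module_action ( *:%R : S -> SI -> SI) /\
     forall r p : S, r *: (mod_pi I p : SI) = mod_pi I (r * p)) /\
    (exists ract : SI -> C -> SI,
      right_module_action ract /\
      forall (p : S) (b : C),
        ract (mod_pi I p) b = mod_pi I (p * oreC delta (centr_val b))),
    ring_iso C (lend SI) /\
    (is_division_ring A ->
       is_division_ring C /\ is_division_ring (lend SI)) &
    ring_iso C (lend SI) /\ ring_iso (lend SI) (ring_quot (idl_ideal I))].
Proof.
have isoC := centr_lend_iso delta a.
split=> [b|||].
- split=> [/centrP bC i|bC]; first by rewrite -/(plt delta a i b) bC subrr.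
  by apply/centrP => i; apply/eqP; rewrite -subr_eq0; apply/eqP/bC.
- split.
    split; last by move=> r p; rewrite -linearZ.
    split=> [x|r s x|r x y|r s x]; rewrite ?scale1r ?scalerA //.
      exact: scalerDr.
    exact: scalerDl.
  (* Since endomorphisms compose from left to right, the right module axioms reduce to [centr_rmul]
     being a ring morphism with additive values. *)
  exists (fun x b => lend_fun (centr_rmul b) x); split.
    split=> [x|x b c|x y b|x b c].
    + by rewrite rmorph1.
    + by rewrite rmorphM.
    + by rewrite raddfD.
    + by rewrite raddfD.
  by move=> p b; rewrite idl_rmulE.
- split=> // /(centr_division delta a) divC.
  by split=> //; apply: ring_iso_division divC.
- by split=> //; apply: lend_idl_iso.
Qed.
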